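(* Let $\mathcal{G}$ be a sparsity pattern with $n$ $\alpha$-nodes and a single $\beta$-node. If $\mathcal{G}$ is structurally averaged controllable and $|N_{\rm in}(V_\alpha)|<|V_\alpha|=n$, then $\mathcal{G}$ cannot be acyclic.
   Context: Let $n,m$ be positive integers and $\Sigma=[0,1]$. Sparsity patterns. A sparsity pattern is a directed graph $\mathcal{G}=(V,\mathcal{E})$ (self-loops allowed) with node set $V=\{\alpha_1,\ldots,\alpha_n,\beta_1,\ldots,\beta_m\}$ such that no $\beta$-node has an incoming edge. Here $m=1$ (a single $\beta$-node). Put $V_\alpha=\{\alpha_1,\ldots,\alpha_n\}$. $\mathbb{V}(\mathcal{G})$ denotes the vector space of all pairs $(A,B)\in \mathrm{C}^0(\Sigma,\mathbb{R}^{n\times n}\times\mathbb{R}^{n\times m})$ compliant with $\mathcal{G}$, meaning: the $(j,i)$ entry of $A$ is the zero function whenever $(\alpha_i,\alpha_j)\notin\mathcal{E}$, and the $(j,i)$ entry of $B$ is the zero function whenever $(\beta_i,\alpha_j)\notin\mathcal{E}$. Averaged controllability. Given continuous $A:\Sigma\to\mathbb{R}^{n\times n}$ and $B:\Sigma\to\mathbb{R}^{n\times m}$, consider the linear ensemble system $$\frac{\partial}{\partial t}x(t,\sigma)=A(\sigma)x(t,\sigma)+B(\sigma)u(t),\qquad \sigma\in\Sigma,\ t\ge 0, \tag{E}$$ with $x(t,\sigma)\in\mathbb{R}^n$ and a control input $u(t)\in\mathbb{R}^m$ that does not depend on $\sigma$. System (E) is averaged controllable if for any $x_0\in\mathbb{R}^n$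 and any initial profile $x(0,\cdot)\in \mathrm{C}^0(\Sigma,\mathbb{R}^n)$ with $\int_0^1 x(0,\sigma)\,\mathrm{d}\sigma=x_0$, any target $x^*\in\mathbb{R}^n$, and any time $T>0$, there is $u\in \mathrm{L}^1([0,T];\mathbb{R}^m)$ such that $\int_0^1 x(T,\sigma)\,\mathrm{d}\sigma=x^*$. $\mathcal{G}$ is structurally averaged controllable if there is a pair $(A,B)\in\mathbb{V}(\mathcal{G})$ such that (E) is averaged controllable. For $V'\subseteq V$, the set of in-neighbors is $N_{\rm in}(V')=\{v_i\in V \mid \exists\, v_j\in V' \text{ such that } (v_i,v_j)\in\mathcal{E}\}$. Acyclic means having no directed cycle; a self-loop counts as a cycle. *)

(* Defs.v *)
From HB Require Import structures.
From mathcomp Require Import all_boot all_order all_algebra.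
From mathcomp Require Import all_classical all_reals all_analysis.
Set Implicit Arguments.
Unset Strict Implicit.
Unset Printing Implicit Defensive.
Import Order.TTheory GRing.Theory Num.Theory.
Import numFieldTopology.Exports numFieldNormedType.Exports.
Local Open Scope classical_set_scope.
Local Open Scope ring_scope.

(* [inl i] is the node alpha_i and [inr k] is the node beta_k. *)
Definition node (n m : nat) : finType := ('I_n + 'I_m)%type.

Record sparsity_pattern (n m : nat) := SparsityPattern {
  edge : rel (node n m);
  edge_beta : forall (v : node n m) (k : 'I_m), ~~ edge v (inr k)
}.

Definition alpha_nodes (n m : nat) : {set node n m} :=
  [set v : node n m | if v is inl _ then true else false]%SET.

Definition in_neighbors (n m : nat) (G : sparsity_pattern n m)
    (W : {set node n m}) : {set node n m} :=
  [set v : node n m | [exists w in W, edge G v w]]%SET.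

(* [ucycle e [:: v]] is [e v v], so self-loops count as cycles. *)
Definition acyclic (n m : nat) (G : sparsity_pattern n m) : Prop :=
  forall c : seq (node n m), c <> [::] -> ~ ucycle (edge G) c.

(* Only the values on [0, 1] of functions of the parameter sigma matter. *)
Definition compliant (R : realType) (n m : nat) (G : sparsity_pattern n m)
    (A : R -> 'M[R]_n) (B : R -> 'M[R]_(n, m)) : Prop :=
  [/\ {within `[0, 1], continuous A},
      {within `[0, 1], continuous B},
      forall i j : 'I_n, ~~ edge G (inl i) (inl j) ->
        forall sigma : R, sigma \in `[0, 1] -> A sigma j i = 0
    & forall (i : 'I_m) (j : 'I_n), ~~ edge G (inr i) (inl j) ->
        forall sigma : R, sigma \in `[0, 1] -> B sigma j i = 0].

Definition vintegral (R : realType) (n : nat) (a b : R) (f : R -> 'cV[R]_n) :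
    'cV[R]_n :=
  \col_(i < n) \int[lebesgue_measure]_(s in `[a, b]) f s i 0.

Definition L1_control (R : realType) (m : nat) (T : R) (u : R -> 'cV[R]_m) :
    Prop :=
  forall i : 'I_m,
    lebesgue_measure.-integrable `[0, T] (fun t => (u t i 0)%:E).

(* As u is only integrable, the differential equation is understood in the
   sense of Caratheodory, i.e. in integrated form.  The state x(t, .) lives in
   C^0([0, 1], R^n). *)
Definition ensemble_solution (R : realType) (n m : nat)
    (A : R -> 'M[R]_n) (B : R -> 'M[R]_(n, m)) (T : R)
    (u : R -> 'cV[R]_m) (xi : R -> 'cV[R]_n) (x : R -> R -> 'cV[R]_n) : Prop :=
  [/\ forall t : R, t \in `[0, T] -> {within `[0, 1], continuous (x t)},
      forall sigma : R, sigma \in `[0, 1] ->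
        {within `[0, T], continuous (fun t => x t sigma)}
    & forall sigma t : R, sigma \in `[0, 1] -> t \in `[0, T] ->
        x t sigma = xi sigma +
          vintegral 0 t (fun s => A sigma *m x s sigma + B sigma *m u s)].

Definition averaged_controllable (R : realType) (n m : nat)
    (A : R -> 'M[R]_n) (B : R -> 'M[R]_(n, m)) : Prop :=
  forall (x0 : 'cV[R]_n) (xi : R -> 'cV[R]_n),
    {within `[0, 1], continuous xi} -> vintegral 0 1 xi = x0 ->
  forall (xstar : 'cV[R]_n) (T : R), 0 < T ->
  exists (u : R -> 'cV[R]_m) (x : R -> R -> 'cV[R]_n),
    [/\ L1_control T u, ensemble_solution A B T u xi x
      & vintegral 0 1 (x T) = xstar].

Definition structurally_averaged_controllable (R : realType) (n m : nat)
    (G : sparsity_pattern n m) : Prop :=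
  exists (A : R -> 'M[R]_n) (B : R -> 'M[R]_(n, m)),
    compliant G A B /\ averaged_controllable A B.

(* Main.v *)
Require Import Defs.
From HB Require Import structures.
From mathcomp Require Import all_boot all_order all_algebra.
From mathcomp Require Import all_classical all_reals all_analysis.
Set Implicit Arguments.
Unset Strict Implicit.
Unset Printing Implicit Defensive.
Import Order.TTheory GRing.Theory Num.Theory.
Import numFieldTopology.Exports numFieldNormedType.Exports.
Local Open Scope ring_scope.

(** In an acyclic pattern a walk never repeats a node, and every node of a walk
except the last one is an in-neighbor of an [alpha]-node.  So no walk has more
than [#|in_neighbors G (alpha_nodes n 1)| < n] edges.  The entries of [A ^ k]
and [A ^ k * B] are sums over walks with [k] edges between [alpha]-nodes and
walks with [k + 1] edges starting at the [beta]-node, so for every [sigma]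
both [A sigma ^ n] and [A sigma ^ (n - 1) * B sigma] vanish
([iter_mulmx_eq0], [iter_mulmx_input_eq0]).

Fix the zero initial profile and write [I] for the operator that integrates
from [0] in time.  A solution satisfies [x = B * I u + A * I x]; substituting
this equation [n] times into itself leaves the remainder [A ^ n * I ^ n x = 0]
([iterated_primitive_expansion]), whence
[x T sigma = \sum_(j < n - 1) A sigma ^ j * B sigma * (I ^ j.+1 u) T].
As there is a single input, the numbers [(I ^ j.+1 u) T] factor out of the
integral over [sigma], and the averaged state lies in the span of the [n - 1]
vectors [\int A ^ j * B], whatever the control is ([averaged_state]).  A nonzero
row vector annihilates these vectors ([common_annihilator]), so some target is
not reached. *)

(** * Walks in acyclic patterns *)

(** The stretch between two visits of the same node would be a cycle; the
induction on the walk makes this cycle simple, as [acyclic] requires. *)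
Lemma acyclic_uniq (n m : nat) (G : sparsity_pattern n m) :
  acyclic G -> forall x p, path (edge G) x p -> uniq (x :: p).
Proof.
move=> acG x p; elim: p x => [//|y p IHp] x exp.
have /andP[_ /IHp Uyp] := exp.
rewrite /= -/(uniq (y :: p)) Uyp andbT; apply/negP => x_yp.
move: exp Uyp; case/splitPr: x_yp => p1 p2.
rewrite -cat_rcons cat_path => /andP[ex _].
rewrite cat_uniq => /and3P[Up1 _ _].
(* [p1] is the stretch of the walk strictly between the two visits of [x]. *)
apply: (acG (x :: p1)) => //; apply/andP; split=> //.
by move: Up1; rewrite rcons_uniq.
Qed.

Lemma card_alpha_nodes (n m : nat) : #|alpha_nodes n m| = n.
Proof.
rewrite -[RHS]card_ord -(card_imset _ (@inl_inj 'I_n 'I_m)).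
apply: eq_card => -[i|k]; rewrite !inE; first by rewrite imset_f.
by symmetry; apply/negP => /imsetP[].
Qed.

(** Dropping the last node of a walk leaves as many distinct nodes as the walk
has edges.  Each is the source of an edge, whose target is an [alpha]-node
because nothing points to a [beta]-node. *)
Lemma size_walk (n m : nat) (G : sparsity_pattern n m) x p :
  acyclic G -> path (edge G) x p ->
  (size p <= #|in_neighbors G (alpha_nodes n m)|)%N.
Proof.
move=> acG exp; rewrite -(size_belast x p).
have Ub : uniq (belast x p).
  by have := acyclic_uniq acG exp; rewrite lastI rcons_uniq => /andP[].
rewrite -(card_uniqP Ub); apply: subset_leq_card; apply/fintype.subsetP => v.
elim: p x exp {Ub} => [//|y p IHp] x /= /andP[exy eyp].
rewrite inE => /predU1P[->|]; last exact: IHp.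
rewrite inE; apply/existsP; exists y; rewrite exy andbT inE.
by case: y exy {eyp IHp} => // k; rewrite (negPf (edge_beta G _ _)).
Qed.

(** A nonzero entry of [A ^ k * M] needs a nonzero term in its expansion as a
sum over walks.  The edge convention is that of sparsity patterns: [A j i]
belongs to the edge from [i] to [j]. *)
Lemma iter_mulmx_walk (F : nzRingType) (n m k : nat) (e : rel 'I_n)
    (A : 'M[F]_n) (M : 'M[F]_(n, m)) (i : 'I_n) (l : 'I_m) :
  (forall i j, A j i != 0 -> e i j) -> iter k (mulmx A) M i l != 0 ->
  exists i0 p, [/\ path e i0 p, last i0 p = i, size p = k & M i0 l != 0].
Proof.
move=> eA; elim: k i => [|k IHk] i /=; first by exists i, [::].
rewrite mxE; case: (pickP (fun j => A i j * iter k (mulmx A) M j l != 0)).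
  move=> j Aj _; have /IHk[i0 [p [ep pj szp M0]]] : iter k (mulmx A) M j l != 0.
    by apply: contraNneq Aj => ->; rewrite mulr0.
  exists i0, (rcons p i); rewrite rcons_path ep pj last_rcons size_rcons szp.
  by split=> //; apply: eA; apply: contraNneq Aj => ->; rewrite mul0r.
by move=> A0; rewrite big1 ?eqxx// => j _; apply/eqP; rewrite -[_ == 0]negbK A0.
Qed.

Lemma iter_mulmx_eq0 (R : realType) (n m k l : nat) (G : sparsity_pattern n m)
    (A : R -> 'M[R]_n) (B : R -> 'M[R]_(n, m)) (s : R) (M : 'M[R]_(n, l)) :
  acyclic G -> compliant G A B -> s \in `[0, 1] ->
  (#|in_neighbors G (alpha_nodes n m)| < k)%N ->
  iter k (mulmx (A s)) M = 0.
Proof.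
move=> acG [_ _ A0 _] s01 ltk; apply/matrixP => i j; rewrite [RHS]mxE.
apply/eqP/negPn/negP.
case/(iter_mulmx_walk (e := relpre inl (edge G))) => [i1 j1|i0 [p [ep _ szp _]]].
  by apply: contraNT => /= /A0 ->.
have := size_walk acG (etrans (path_map _ _) ep).
by rewrite size_map szp leqNgt ltk.
Qed.

(** The [beta]-node prepends one edge to the walk, which is why one power of [A]
fewer than in [iter_mulmx_eq0] already gives zero. *)
Lemma iter_mulmx_input_eq0 (R : realType) (n m k : nat)
    (G : sparsity_pattern n m) (A : R -> 'M[R]_n) (B : R -> 'M[R]_(n, m))
    (s : R) :
  acyclic G -> compliant G A B -> s \in `[0, 1] ->
  (#|in_neighbors G (alpha_nodes n m)| < k.+1)%N ->
  iter k (mulmx (A s)) (B s) = 0.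
Proof.
move=> acG [_ _ A0 B0] s01 ltk; apply/matrixP => i j; rewrite [RHS]mxE.
apply/eqP/negPn/negP.
case/(iter_mulmx_walk (e := relpre inl (edge G))) => [i1 j1|i0 [p [ep _ szp B_0]]].
  by apply: contraNT => /= /A0 ->.
have ej : edge G (inr j) (inl i0) by apply: contraNT B_0 => /B0 ->.
have := @size_walk _ _ G (inr j) (map inl (i0 :: p)) acG.
by rewrite /= ej (etrans (path_map _ _) ep) size_map szp leqNgt ltk => /(_ isT).
Qed.

(** * Integrals of vector-valued functions *)

Definition vintegrable (R : realType) (n : nat) (a b : R) (f : R -> 'cV[R]_n) :=
  forall i : 'I_n,
    lebesgue_measure.-integrable `[a, b]%classic (fun s => (f s i 0)%:E).

Lemma Rintegral_sum (R : realType) (a b : R) (I : Type) (r : seq I)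
    (f : I -> R -> R) :
  (forall i, lebesgue_measure.-integrable `[a, b]%classic (EFin \o f i)) ->
  \int[lebesgue_measure]_(s in `[a, b]) (\sum_(i <- r) f i s) =
  \sum_(i <- r) \int[lebesgue_measure]_(s in `[a, b]) f i s.
Proof.
move=> intf; elim: r => [|i r IHr].
  by under eq_Rintegral do rewrite big_nil; rewrite big_nil Rintegral_cst// mul0r.
under eq_Rintegral do rewrite big_cons; rewrite big_cons -IHr RintegralD//.
rewrite (_ : EFin \o _ = (fun s : measurableTypeR R => \sum_(j <- r) (f j s)%:E)%E).
  by apply: integrable_sum => // j _; exact: intf.
by apply: boolp.funext => s; rewrite sumEFin.
Qed.

Section VectorIntegral.
Context (R : realType) (a b : R).
Implicit Types (n m : nat).

Lemma eq_vintegral n (f g : R -> 'cV[R]_n) :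
  {in `[a, b], f =1 g} -> vintegral a b f = vintegral a b g.
Proof.
move=> fg; apply/colP => i; rewrite !mxE; apply: eq_Rintegral => s.
by rewrite inE/= => /fg ->.
Qed.

Lemma vintegrableS n c (f : R -> 'cV[R]_n) :
  c \in `[a, b] -> vintegrable a b f -> vintegrable a c f.
Proof.
rewrite in_itv/= => /andP[_ cb] intf i.
apply: integrableS (intf i) => //= s; rewrite /= !in_itv/= => /andP[-> sc] /=.
exact: le_trans cb.
Qed.

Lemma vintegrableD n (f g : R -> 'cV[R]_n) :
  vintegrable a b f -> vintegrable a b g -> vintegrable a b (fun s => f s + g s).
Proof.
move=> intf intg i; under [X in _.-integrable _ X]eq_fun do rewrite mxE EFinD.
exact: integrableD.
Qed.

Lemma vintegrable_mulmx n m (M : 'M[R]_(m, n)) (f : R -> 'cV[R]_n) :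
  vintegrable a b f -> vintegrable a b (fun s => M *m f s).
Proof.
move=> intf i; under [X in _.-integrable _ X]eq_fun do rewrite mxE -sumEFin.
apply: integrable_sum => // j _; under [X in _.-integrable _ X]eq_fun do rewrite EFinM.
exact: integrableZl.
Qed.

Lemma vintegralD n (f g : R -> 'cV[R]_n) :
  vintegrable a b f -> vintegrable a b g ->
  vintegral a b (fun s => f s + g s) = vintegral a b f + vintegral a b g.
Proof.
move=> intf intg; apply/colP => i.
rewrite !mxE -RintegralD; [|by []|exact: intf|exact: intg].
by apply: eq_Rintegral => s _; rewrite mxE.
Qed.

Lemma vintegral_sum n k (f : 'I_k -> R -> 'cV[R]_n) :
  (forall i, vintegrable a b (f i)) ->
  vintegral a b (fun s => \sum_i f i s) = \sum_i vintegral a b (f i).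
Proof.
move=> intf; apply/colP => i; rewrite !mxE summxE.
under eq_Rintegral => s _ do rewrite summxE.
rewrite Rintegral_sum => [|j]; last exact: intf.
by apply: eq_bigr => j _; rewrite mxE.
Qed.

Lemma vintegral_mulmx n m (M : 'M[R]_(m, n)) (f : R -> 'cV[R]_n) :
  vintegrable a b f ->
  vintegral a b (fun s => M *m f s) = M *m vintegral a b f.
Proof.
move=> intf; apply/colP => i; rewrite !mxE.
under eq_Rintegral => s _ do rewrite mxE.
rewrite Rintegral_sum => [|j].
  by apply: eq_bigr => j _; rewrite mxE RintegralZl//; exact: intf.
rewrite [X in _.-integrable _ X](_ : _ = fun s => (M i j)%:E * (f s j 0)%:E)%E//.
exact: integrableZl.
Qed.

Lemma vintegrable_mulmxr n (f : R -> 'cV[R]_n) (c : 'cV[R]_1) :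
  vintegrable a b f -> vintegrable a b (fun s => f s *m c).
Proof.
move=> intf i; under [X in _.-integrable _ X]eq_fun do rewrite mxE big_ord1 EFinM.
exact: integrableZr.
Qed.

Lemma vintegral_mulmxr n (f : R -> 'cV[R]_n) (c : 'cV[R]_1) :
  vintegrable a b f ->
  vintegral a b (fun s => f s *m c) = vintegral a b f *m c.
Proof.
move=> intf; apply/colP => i; rewrite !mxE big_ord1 mxE.
rewrite -RintegralZr; [|by []|exact: intf].
by apply: eq_Rintegral => s _; rewrite mxE big_ord1.
Qed.

Lemma vintegrable_continuous n (f : R -> 'cV[R]_n) :
  (forall i, {within `[a, b], continuous (fun s => f s i 0)}%classic) ->
  vintegrable a b f.
Proof.
move=> cf i; apply: continuous_compact_integrable => //.
exact: segment_compact.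
Qed.

(** The primitive of an integrable function is continuous, so integration can
be iterated starting from a control that is merely integrable. *)
Lemma vintegrable_primitive n (f : R -> 'cV[R]_n) :
  a <= b -> vintegrable a b f -> vintegrable a b (fun t => vintegral a t f).
Proof.
move=> ab intf; apply: vintegrable_continuous => i.
have /= := parameterized_integral_continuous ab (intf i).
rewrite /parameterized_integral.
by under [X in _ -> continuous X]eq_fun do rewrite mxE.
Qed.

End VectorIntegral.

(** * Continuity of matrix-valued functions *)

Section MatrixContinuity.
Context (R : realType) (D : set R).

(** Products reduce to sums and products of scalar functions in this form, and
integrability is only ever asked entry by entry. *)
Definition entrywise_continuous m n (f : R -> 'M[R]_(m, n)) :=
  forall i j, {within D, continuous (fun s => f s i j)}%classic.

Lemma continuous_entrywise m n (f : R -> 'M[R]_(m, n)) :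
  {within D, continuous f}%classic -> entrywise_continuous f.
Proof.
move=> cf i j s.
exact: (continuous_comp (cf s) (@coord_continuous _ _ _ i j _)).
Qed.

Lemma entrywise_continuousM m n p (f : R -> 'M[R]_(m, n))
    (g : R -> 'M[R]_(n, p)) :
  entrywise_continuous f -> entrywise_continuous g ->
  entrywise_continuous (fun s => f s *m g s).
Proof.
move=> cf cg i j; under [X in continuous X]eq_fun do rewrite mxE.
apply: (continuous_big (op := +%R)) => [|k _ s]; first exact: add_continuous.
exact: continuousM (cf i k s) (cg k j s).
Qed.

Lemma entrywise_continuous_iter n p k (f : R -> 'M[R]_n)
    (g : R -> 'M[R]_(n, p)) :
  entrywise_continuous f -> entrywise_continuous g ->
  entrywise_continuous (fun s => iter k (mulmx (f s)) (g s)).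
Proof. by move=> cf cg; elim: k => //= k; apply: entrywise_continuousM. Qed.

End MatrixContinuity.

(** * Reachable averages *)

(** Substituting the equation into itself: if [x = B U + A I x] then [I x]
satisfies the same equation with [I U] in place of [U], because [I] commutes
with constant matrices.  This is the Picard expansion of the solution, with a
remainder that disappears when [A] is nilpotent. *)
Lemma iterated_primitive_expansion (R : realType) (n m : nat) (T : R)
    (A : 'M[R]_n) (B : 'M[R]_(n, m)) (x : R -> 'cV[R]_n) (U : R -> 'cV[R]_m) k :
  let I p (f : R -> 'cV[R]_p) t := vintegral 0 t f in
  0 <= T -> vintegrable 0 T x -> vintegrable 0 T U ->
  {in `[0, T], forall t, x t = B *m U t + A *m I n x t} ->
  {in `[0, T], forall t,
    x t = \sum_(j < k) iter j (mulmx A) B *m iter j (I m) U t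
          + iter k (mulmx A) (iter k (I n) x t)}.
Proof.
move=> I T0; elim: k x U => [|k IHk] x U intx intU xE t tT.
  by rewrite big_ord0 add0r.
have IxE : {in `[0, T], forall s,
    I n x s = B *m I m U s + A *m I n (I n x) s}.
  move=> s sT; have sub p f : vintegrable 0 T f -> @vintegrable _ p 0 s f.
    exact: vintegrableS.
  rewrite /I -!vintegral_mulmx; last 2 first.
    by apply: sub; exact: vintegrable_primitive.
    exact: sub.
  rewrite -vintegralD; last 2 first.
    by apply: vintegrable_mulmx; exact: sub.
    by apply/vintegrable_mulmx/sub; exact: vintegrable_primitive.
  apply: eq_vintegral => r; rewrite in_itv/= => /andP[r0 rs]; apply: xE.
  move: sT; rewrite !in_itv/= r0 => /andP[_]; exact: le_trans.
rewrite xE// (IHk (I n x) (I m U)) //; last 2 first.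
  exact: vintegrable_primitive.
  exact: vintegrable_primitive.
rewrite mulmxDr mulmx_sumr addrA big_ord_recl /= -!iterSr; congr (_ + _ + _).
by apply: eq_bigr => j _; rewrite -iterSr mulmxA.
Qed.

(** The matrix with columns [v i] has rank at most [k < n], so its left kernel
is nonzero. *)
Lemma common_annihilator (F : fieldType) (n k : nat) (v : 'I_k -> 'cV[F]_n) :
  (k < n)%N -> exists2 w : 'rV[F]_n, w != 0 & forall i, w *m v i = 0.
Proof.
move=> ltkn; pose M := \matrix_(i < n, j < k) v j i 0.
have /rowV0Pn[w /sub_kermxP wM w0] : kermx M != 0.
  rewrite kermx_eq0; apply: contraTN ltkn => /eqP <-.
  by rewrite -leqNgt rank_leq_col.
exists w => // i; have -> : v i = col i M by apply/colP => j; rewrite !mxE.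
by rewrite colE mulmxA wM mul0mx.
Qed.

Lemma mulmx_neq0 (F : fieldType) (n : nat) (w : 'rV[F]_n) :
  w != 0 -> exists v : 'cV[F]_n, w *m v != 0.
Proof.
case/rV0Pn=> i wi; exists (delta_mx i 0); rewrite -colE.
by apply: contraNneq wi => /matrixP/(_ 0 0); rewrite !mxE => ->.
Qed.

(** The span on the right does not depend on the control.  The nilpotency index
[k.+1] kills the remainder of the expansion, and [A ^ k * B = 0] leaves only [k]
of its [k.+1] terms, one fewer than the dimension once [n = k.+1]. *)
Lemma averaged_state (R : realType) (n k : nat) (A : R -> 'M[R]_n)
    (B : R -> 'cV[R]_n) (T : R) (u : R -> 'cV[R]_1) (x : R -> R -> 'cV[R]_n) :
  0 < T ->
  {within `[0, 1], continuous A}%classic ->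
  {within `[0, 1], continuous B}%classic ->
  (forall s (M : 'cV[R]_n), s \in `[0, 1] -> iter k.+1 (mulmx (A s)) M = 0) ->
  (forall s, s \in `[0, 1] -> iter k (mulmx (A s)) (B s) = 0) ->
  L1_control T u -> ensemble_solution A B T u (fun=> 0) x ->
  exists c : 'I_k -> 'cV[R]_1, vintegral 0 1 (x T) =
    \sum_(j < k) vintegral 0 1 (fun s => iter j (mulmx (A s)) (B s)) *m c j.
Proof.
move=> T0 cA cB nilA nilB intu [cx cxt xE].
pose U t := vintegral 0 t u.
have TT : T \in `[0, T] by rewrite in_itv/= lexx ltW.
have xTE : {in `[0, 1], forall s, x T s = \sum_(j < k)
    iter j (mulmx (A s)) (B s) *m iter j (fun f t => vintegral 0 t f) U T}.
  move=> s s01.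
  have intx : vintegrable 0 T (fun t => x t s).
    by apply: vintegrable_continuous => i; apply: continuous_entrywise; exact: cxt.
  have intU : vintegrable 0 T U by exact: vintegrable_primitive (ltW T0) intu.
  have xsE : {in `[0, T], forall t,
      x t s = B s *m U t + A s *m vintegral 0 t (fun r => x r s)}.
    move=> t tT; have intxt := vintegrableS tT intx.
    have intut := vintegrableS tT intu.
    rewrite xE// add0r addrC vintegralD; try exact: vintegrable_mulmx.
    by rewrite !vintegral_mulmx.
  rewrite (iterated_primitive_expansion k.+1 (ltW T0) intx intU xsE TT).
  by rewrite nilA// big_ord_recr /= nilB// mul0mx !addr0.
exists (fun j => iter j (fun f t => vintegral 0 t f) U T).
have intAB j : vintegrable 0 1 (fun s => iter j (mulmx (A s)) (B s)).
  apply: vintegrable_continuous => i.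
  by apply: entrywise_continuous_iter; exact: continuous_entrywise.
rewrite (eq_vintegral xTE) vintegral_sum => [|j]; last exact: vintegrable_mulmxr.
by apply: eq_bigr => j _; rewrite vintegral_mulmxr.
Qed.

Theorem corollary2p6 (R : realType) (n : nat) (G : sparsity_pattern n 1)
    (hn : (0 < n)%N)
    (hG : structurally_averaged_controllable R G)
    (hN : (#|in_neighbors G (alpha_nodes n 1)| < #|alpha_nodes n 1|)%N) :
  ~ acyclic G.
Proof.
move=> acG; case: hG => [A [B [AB ctrl]]].
case: n G hn hN acG A B AB ctrl => [//|k] G _ + acG A B AB ctrl.
rewrite card_alpha_nodes => ltN.
have [w w0 wAB] := common_annihilator
  (fun j : 'I_k => vintegral 0 1 (fun s => iter j (mulmx (A s)) (B s)))
  (ltnSn k).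
have [xstar wxstar] := mulmx_neq0 w0.
(* The zero profile makes the reachable averages a linear subspace. *)
have c0 : {within `[0, 1], continuous (fun _ : R => 0 : 'cV[R]_k.+1)}%classic.
  exact: cst_continuous.
have [u [x [intu solx xT]]] := ctrl _ _ c0 erefl xstar 1 ltr01.
case: (AB) => cA cB _ _.
have nilA s (M : 'cV[R]_k.+1) :
  s \in `[0, 1] -> iter k.+1 (mulmx (A s)) M = 0.
  by move=> s01; exact: iter_mulmx_eq0 acG AB s01 ltN.
have nilB s : s \in `[0, 1] -> iter k (mulmx (A s)) (B s) = 0.
  by move=> s01; exact: iter_mulmx_input_eq0 acG AB s01 ltN.
have [c cE] := averaged_state ltr01 cA cB nilA nilB intu solx.
move/eqP: wxstar; rewrite -xT cE mulmx_sumr big1// => j _.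
by rewrite mulmxA wAB mul0mx.
Qed.
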